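(* Let $p=4$, let $X=(X_1,\ldots,X_4)\in\mathbb{R}^{n\times4}$ be a fair design with $X_1^TX_2=-\hat\rho$, $0<\hat\rho<1$, $\hat\varphi^2:=1-\hat\rho$, and let $\beta^0\in\mathbb{R}^4$ have active set $S_0=\{1,2\}$, so $S_0^c=\{3,4\}$. Let $$X_3=C(X_1+X_2)/2+U+V,\qquad X_4=C(X_1+X_2)/2+U-V,$$ where $C>1$, $C^2\hat\varphi^2/2<1$, $U$ and $V$ are orthogonal to $X_1$ and $X_2$, and $U^TV=0$. Set $\hat\tau^2:=U^TU$, where $0<\hat\tau^2<1-C^2\hat\varphi^2/2$. Then $$\hat\phi^2(S_0)=\frac{\hat\varphi^2\hat\tau^2}{C^2\hat\varphi^2/2+\hat\tau^2},\qquad\hat\Gamma^2(S_0)=\frac{2}{\hat\varphi^2}+\frac{C^2}{\hat\tau^2}.$$ Let $\lambda>0$ and $\beta_1^0\ge\beta_2^0\ge\lambda/\hat\varphi^2+\lambda C(C-1)/(2\hat\tau^2)$. Then the noiseless Lasso $\beta^*$ satisfies $$\|X(\beta^*-\beta^0)\|_2^2+2\lambda\|\beta_{-S_0}^*\|_1=\lambda^2\hat\Gamma^2(S_0)-\frac{\lambda^2}{\hat\tau^2}.$$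
   Context: Fair design: all columns satisfy $\|X_j\|_2=1$ and there are no $j\ne k$ and constant $b$ with $X_j=bX_k$. The noiseless Lasso is $\beta^*:=\arg\min_{\beta\in\mathbb{R}^p}\{\|X(\beta-\beta^0)\|_2^2+2\lambda\|\beta\|_1\}$. For $S\subset\{1,\ldots,p\}$, $\beta_S$ is the vector with entries $\beta_j$ for $j\in S$ and $0$ otherwise, and $\beta_{-S}:=\beta_{S^c}$. The compatibility constant is $\hat\phi^2(S):=\min\{|S|\,\|X\beta\|_2^2:\ \|\beta_S\|_1=1,\ \|\beta_{-S}\|_1\le1\}$, and the effective sparsity is $\hat\Gamma^2(S):=|S|/\hat\phi^2(S)$. *)

(* Defs.v *)
From HB Require Import structures.
From mathcomp Require Import all_boot all_order all_algebra.
From mathcomp Require Import boolp classical_sets reals.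
Set Implicit Arguments.
Unset Strict Implicit.
Unset Printing Implicit Defensive.
Import Order.TTheory GRing.Theory Num.Theory.
Local Open Scope ring_scope.

Section Norms.
Variables (R : realType) (n : nat).
Implicit Types u v : 'cV[R]_n.

Definition dot u v : R := (u^T *m v) 0 0.
Definition l2norm u : R := Num.sqrt (dot u u).
Definition l1norm u : R := \sum_i `|u i 0|.

Definition active u : {set 'I_n} := [set i | u i 0 != 0]%SET.

(* beta_S, keeping the ambient dimension; beta_{-S} is [restrict (~: S) beta]. *)
Definition restrict (S : {set 'I_n}) u : 'cV[R]_n :=
  \col_i (if i \in S then u i 0 else 0).

End Norms.

(* The least element of A; the value is 0 (junk) when A has no least element. *)
Definition set_min (R : realType) (A : set R) : R :=
  xget 0 [set m | A m /\ lbound A m]%classic.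

Section Lasso.
Variables (R : realType) (n p : nat) (X : 'M[R]_(n, p)).
Implicit Types (beta : 'cV[R]_p) (S : {set 'I_p}).

Definition fair_design : Prop :=
  (forall j, l2norm (col j X) = 1) /\
  ~ (exists j k (b : R), j != k /\ col j X = b *: col k X).

(* No square root is taken: compat2 and eff_sparsity2 are the squared
   quantities hat-phi^2(S) and hat-Gamma^2(S) themselves. *)
Definition compat2 S : R :=
  set_min [set #|S|%:R * l2norm (X *m beta) ^+ 2 | beta in
    [set beta : 'cV[R]_p | l1norm (restrict S beta) = 1 /\
                           l1norm (restrict (~: S) beta) <= 1]]%classic.

Definition eff_sparsity2 S : R := #|S|%:R / compat2 S.

Definition lasso_objective beta0 (lambda : R) beta : R :=
  l2norm (X *m (beta - beta0)) ^+ 2 + 2 * lambda * l1norm beta.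

Definition noiseless_lasso beta0 (lambda : R) beta : Prop :=
  forall b, lasso_objective beta0 lambda beta <= lasso_objective beta0 lambda b.

End Lasso.

(* The 1-based indices 1, ..., 4 of the four columns. *)
Definition j1 : 'I_4 := @Ordinal 4 0 isT.
Definition j2 : 'I_4 := @Ordinal 4 1 isT.
Definition j3 : 'I_4 := @Ordinal 4 2 isT.
Definition j4 : 'I_4 := @Ordinal 4 3 isT.

(* Main.v *)
(* In the coordinates [a + b + C (c + d)], [a - b], [c + d], [c - d] the form
   |X beta|^2 is a sum of squares with positive coefficients.  The minimum in
   the compatibility constant is then a one-variable quadratic minimum, reached
   at a = b and c = d.  The vector with
     beta_1 - beta0_1 = beta_2 - beta0_2
       = - lambda / phi^2 - lambda C (C - 1) / (2 tau^2),
     beta_3 = beta_4 = lambda (C - 1) / (2 tau^2)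
   is nonnegative and satisfies the KKT conditions with all signs 1; the form
   being positive definite, it is the only minimizer of the Lasso objective. *)
Require Import Defs.
From HB Require Import structures.
From mathcomp Require Import all_boot all_order all_algebra.
From mathcomp Require Import boolp classical_sets reals.
From mathcomp Require Import ring lra.
Set Implicit Arguments.
Unset Strict Implicit.
Unset Printing Implicit Defensive.
Import Order.TTheory GRing.Theory Num.Theory.
Local Open Scope ring_scope.

Section Dot.
Variables (R : realType) (n : nat).
Implicit Types u v w : 'cV[R]_n.

Lemma dotC u v : dot u v = dot v u.
Proof. by rewrite /dot !mxE; apply: eq_bigr => i _; rewrite !mxE mulrC. Qed.

Lemma dotDl u v w : dot (u + v) w = dot u w + dot v w.
Proof. by rewrite /dot linearD mulmxDl mxE. Qed.

Lemma dotDr u v w : dot w (u + v) = dot w u + dot w v.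
Proof. by rewrite dotC dotDl !(dotC w). Qed.

Lemma dotZl a u v : dot (a *: u) v = a * dot u v.
Proof. by rewrite /dot linearZ -scalemxAl mxE. Qed.

Lemma dotZr a u v : dot u (a *: v) = a * dot u v.
Proof. by rewrite dotC dotZl dotC. Qed.

Lemma dotNl u v : dot (- u) v = - dot u v.
Proof. by rewrite -scaleN1r dotZl mulN1r. Qed.

Lemma dotNr u v : dot u (- v) = - dot u v.
Proof. by rewrite dotC dotNl dotC. Qed.

Lemma sqr_l2norm u : l2norm u ^+ 2 = dot u u.
Proof.
rewrite /l2norm sqr_sqrtr // /dot mxE.
by apply: sumr_ge0 => i _; rewrite mxE -expr2 sqr_ge0.
Qed.

End Dot.

Lemma set_min_eq (R : realType) (A : set R) m :
  A m -> lbound A m -> set_min A = m.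
Proof.
move=> Am lbm; apply: xget_unique => // x [Ax lbx].
by apply/eqP; rewrite eq_le lbm // lbx.
Qed.

Lemma sum_I4 (V : nmodType) (F : 'I_4 -> V) :
  \sum_i F i = F j1 + F j2 + F j3 + F j4.
Proof.
rewrite !big_ord_recr big_ord0 /= add0r.
by congr (F _ + F _ + F _ + F _); apply: val_inj.
Qed.

Section FourColumns.
Variable R : realType.

Definition col4 (a b c d : R) : 'cV[R]_4 := \col_i nth 0 [:: a; b; c; d] i.

Lemma mulmx_I4 n (X : 'M[R]_(n, 4)) (u : 'cV[R]_4) :
  X *m u = u j1 0 *: col j1 X + u j2 0 *: col j2 X
           + u j3 0 *: col j3 X + u j4 0 *: col j4 X.
Proof.
apply/matrixP => i k; rewrite !mxE sum_I4 !ord1.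
by rewrite !(mulrC (u _ _)).
Qed.

Lemma l1norm_I4 (u : 'cV[R]_4) :
  l1norm u = `|u j1 0| + `|u j2 0| + `|u j3 0| + `|u j4 0|.
Proof. by rewrite /l1norm sum_I4. Qed.

Lemma l1norm_restrict12 (u : 'cV[R]_4) :
  l1norm (restrict [set j1; j2]%SET u) = `|u j1 0| + `|u j2 0|.
Proof. by rewrite l1norm_I4 !mxE !inE /= normr0 !addr0. Qed.

Lemma l1norm_restrict34 (u : 'cV[R]_4) :
  l1norm (restrict (~: [set j1; j2]%SET) u) = `|u j3 0| + `|u j4 0|.
Proof. by rewrite l1norm_I4 !mxE !inE /= normr0 !add0r. Qed.

(* |X (a, b, c, d)|^2, with [w] standing for V^T V. *)
Definition design_form (rho tau2 w C a b c d : R) : R :=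
  (1 - rho) / 2 * (a + b + C * (c + d)) ^+ 2 + (1 + rho) / 2 * (a - b) ^+ 2
  + tau2 * (c + d) ^+ 2 + w * (c - d) ^+ 2.

(** Positive definiteness: all four weights are positive, so each square vanishes, and the four
    linear forms are independent. It gives uniqueness of the Lasso solution. *)
Lemma design_form_le0 rho tau2 w C a b c d :
  0 < rho < 1 -> 0 < tau2 -> 0 < w ->
  design_form rho tau2 w C a b c d <= 0 -> [/\ a = 0, b = 0, c = 0 & d = 0].
Proof.
move=> /andP[r0 r1] t0 w0; rewrite /design_form => q0.
have sq0 (k x : R) : 0 < k -> k * x ^+ 2 <= 0 -> x = 0.
  move=> k0; rewrite pmulr_rle0 // => h; apply/eqP.
  by rewrite -sqrf_eq0 eq_le h sqr_ge0.
have k1 : 0 < (1 - rho) / 2 by lra.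
have k2 : 0 < (1 + rho) / 2 by lra.
have p1 := mulr_ge0 (ltW k1) (sqr_ge0 (a + b + C * (c + d))).
have p2 := mulr_ge0 (ltW k2) (sqr_ge0 (a - b)).
have p3 := mulr_ge0 (ltW t0) (sqr_ge0 (c + d)).
have p4 := mulr_ge0 (ltW w0) (sqr_ge0 (c - d)).
have e3 : c + d = 0 by apply: (sq0 tau2) => //; lra.
have e4 : c - d = 0 by apply: (sq0 w) => //; lra.
have e1 : a + b + C * (c + d) = 0 by apply: (sq0 _ _ k1); lra.
have e2 : a - b = 0 by apply: (sq0 _ _ k2); lra.
by move: e1; rewrite e3 mulr0 addr0 => e1; split; lra.
Qed.

(* Cauchy-Schwarz for the weights 1/x and C^2/y. *)
Lemma quad_min (x y C t s : R) : 0 < x -> 0 < y ->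
  x * y * t ^+ 2 / (C ^+ 2 * x + y) <= x * (t + C * s) ^+ 2 + y * s ^+ 2.
Proof.
move=> x0 y0.
have d0 : 0 < C ^+ 2 * x + y by rewrite ltr_wpDl // mulr_ge0 ?sqr_ge0 // ltW.
rewrite ler_pdivrMr // -subr_ge0.
have -> : (x * (t + C * s) ^+ 2 + y * s ^+ 2) * (C ^+ 2 * x + y)
    - x * y * t ^+ 2 = (C * x * (t + C * s) + y * s) ^+ 2 by ring.
exact: sqr_ge0.
Qed.

(** The constraint forces [a + b] or [a - b] to be 1 or -1, according to the signs. Equal signs are
    handled by [quad_min], opposite signs by the square of [a - b] alone. *)
Lemma design_form_compat rho tau2 w C a b c d :
  0 < rho < 1 -> 0 < tau2 -> 0 < w -> `|a| + `|b| = 1 ->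
  (1 - rho) * tau2 / (C ^+ 2 * (1 - rho) / 2 + tau2)
    <= 2 * design_form rho tau2 w C a b c d.
Proof.
move=> /andP[r0 r1] t0 w0 ab1; rewrite /design_form.
have k1 : 0 < (1 - rho) / 2 by lra.
have k2 : 0 < (1 + rho) / 2 by lra.
have D0 : 0 < C ^+ 2 * ((1 - rho) / 2) + tau2.
  by rewrite ltr_wpDl // mulr_ge0 ?sqr_ge0 // ltW.
have p1 := mulr_ge0 (ltW k1) (sqr_ge0 (a + b + C * (c + d))).
have p2 := mulr_ge0 (ltW k2) (sqr_ge0 (a - b)).
have p3 := mulr_ge0 (ltW t0) (sqr_ge0 (c + d)).
have p4 := mulr_ge0 (ltW w0) (sqr_ge0 (c - d)).
(* Twice the bound of [quad_min] for x = (1 - rho) / 2, y = [tau2] and t of square 1. *)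
have -> : (1 - rho) * tau2 / (C ^+ 2 * (1 - rho) / 2 + tau2)
    = 2 * ((1 - rho) / 2 * tau2 / (C ^+ 2 * ((1 - rho) / 2) + tau2)).
  by rewrite -(mulrA (C ^+ 2)); field; apply: lt0r_neq0; lra.
set m := _ * tau2 / _.
have [ab|ab] : (a + b) ^+ 2 = 1 \/ (a - b) ^+ 2 = 1.
  move: ab1; case: (ger0P a) => _; case: (ger0P b) => _ h;
    rewrite -(expr1n _ 2) -h; solve [left; ring | right; ring].
- have := quad_min C (a + b) (c + d) k1 t0; rewrite ab mulr1 -/m; lra.
(* Here the square of [a - b] contributes (1 + rho) / 2, which exceeds (1 - rho) / 2. *)
- have : m <= (1 - rho) / 2.
    rewrite /m ler_pdivrMr // ler_pM2l // lerDr.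
    by rewrite mulr_ge0 ?sqr_ge0 // ltW.
  rewrite ab mulr1 in p2 *; lra.
Qed.

End FourColumns.

Section Design.
Variables (R : realType) (n : nat) (X : 'M[R]_(n, 4)).
Variables (rho C : R) (U V : 'cV[R]_n).
Hypothesis hX : fair_design X.
Hypothesis h12 : dot (col j1 X) (col j2 X) = - rho.
Hypothesis hX3 : col j3 X = (C / 2) *: (col j1 X + col j2 X) + U + V.
Hypothesis hX4 : col j4 X = (C / 2) *: (col j1 X + col j2 X) + U - V.
Hypotheses (hU1 : dot U (col j1 X) = 0) (hU2 : dot U (col j2 X) = 0).
Hypotheses (hV1 : dot V (col j1 X) = 0) (hV2 : dot V (col j2 X) = 0).
Hypothesis hUV : dot U V = 0.

Let h21 : dot (col j2 X) (col j1 X) = - rho. Proof. by rewrite dotC. Qed.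
Let h1U : dot (col j1 X) U = 0. Proof. by rewrite dotC. Qed.
Let h2U : dot (col j2 X) U = 0. Proof. by rewrite dotC. Qed.
Let h1V : dot (col j1 X) V = 0. Proof. by rewrite dotC. Qed.
Let h2V : dot (col j2 X) V = 0. Proof. by rewrite dotC. Qed.
Let hVU : dot V U = 0. Proof. by rewrite dotC. Qed.
Let hjj j : dot (col j X) (col j X) = 1.
Proof. by rewrite -sqr_l2norm hX.1 expr1n. Qed.

Let dotE := (dotDl, dotDr, dotZl, dotZr, dotNl, dotNr, h12, h21, hU1, hU2,
  hV1, hV2, h1U, h2U, h1V, h2V, hUV, hVU).

(** The normalization of the third column, expanded by orthogonality. It turns the upper bound on
    [tau2] into positivity of the weight of [c - d]. *)
Lemma dotVV : dot V V = 1 - C ^+ 2 * (1 - rho) / 2 - dot U U.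
Proof.
have := hjj j3; rewrite hX3 !dotE (hjj j1) (hjj j2); lra.
Qed.

(** The vectors X1 + X2, X1 - X2, U, V are pairwise orthogonal, and X u has coefficients (a + b + C
    (c + d)) / 2, (a - b) / 2, c + d, c - d on them. *)
Lemma sqr_l2norm_design u : l2norm (X *m u) ^+ 2 =
  design_form rho (dot U U) (dot V V) C (u j1 0) (u j2 0) (u j3 0) (u j4 0).
Proof.
rewrite sqr_l2norm mulmx_I4 hX3 hX4 !dotE (hjj j1) (hjj j2) /design_form.
by field.
Qed.

End Design.

Theorem lemma12p1 (R : realType) (n : nat) (X : 'M[R]_(n, 4))
  (rho phi2 tau2 C : R) (U V : 'cV[R]_n)
  (beta0 : 'cV[R]_4) (S0 : {set 'I_4})
  (hX : fair_design X)
  (h12 : dot (col j1 X) (col j2 X) = - rho)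
  (hrho : 0 < rho < 1)
  (hphi2 : phi2 = 1 - rho)
  (hS0 : S0 = [set j1; j2]%SET)
  (hact : active beta0 = S0)
  (hX3 : col j3 X = (C / 2) *: (col j1 X + col j2 X) + U + V)
  (hX4 : col j4 X = (C / 2) *: (col j1 X + col j2 X) + U - V)
  (hC : 1 < C)
  (hCphi : C ^+ 2 * phi2 / 2 < 1)
  (hU1 : dot U (col j1 X) = 0) (hU2 : dot U (col j2 X) = 0)
  (hV1 : dot V (col j1 X) = 0) (hV2 : dot V (col j2 X) = 0)
  (hUV : dot U V = 0)
  (htau2 : tau2 = dot U U)
  (htau : 0 < tau2 < 1 - C ^+ 2 * phi2 / 2) :
  [/\ compat2 X S0 = phi2 * tau2 / (C ^+ 2 * phi2 / 2 + tau2),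
      eff_sparsity2 X S0 = 2 / phi2 + C ^+ 2 / tau2 &
      forall (lambda : R) (betas : 'cV[R]_4),
        0 < lambda ->
        beta0 j2 0 <= beta0 j1 0 ->
        lambda / phi2 + lambda * C * (C - 1) / (2 * tau2) <= beta0 j2 0 ->
        noiseless_lasso X beta0 lambda betas ->
        l2norm (X *m (betas - beta0)) ^+ 2
          + 2 * lambda * l1norm (restrict (~: S0) betas)
        = lambda ^+ 2 * eff_sparsity2 X S0 - lambda ^+ 2 / tau2].
Proof.
have tau_gt0 : 0 < tau2 by case/andP: htau.
set w := dot V V.
have w_gt0 : 0 < w.
  rewrite /w (dotVV hX h12 hX3 hU1 hU2 hV1 hV2 hUV) -hphi2 -htau2.
  by case/andP: htau; rewrite subr_gt0.
have qE u : l2norm (X *m u) ^+ 2 =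
    design_form rho tau2 w C (u j1 0) (u j2 0) (u j3 0) (u j4 0).
  by rewrite (sqr_l2norm_design hX h12 hX3 hX4 hU1 hU2 hV1 hV2 hUV) -htau2.
have phi_gt0 : 0 < phi2 by rewrite hphi2; lra.
have D_gt0 : 0 < C ^+ 2 * phi2 / 2 + tau2.
  by rewrite ltr_wpDl // divr_ge0 // mulr_ge0 ?sqr_ge0 // ltW.
have cardS0 : #|S0| = 2 by rewrite hS0 cards2.
have compatE : compat2 X S0 = phi2 * tau2 / (C ^+ 2 * phi2 / 2 + tau2).
  rewrite /compat2; apply: set_min_eq; last first.
    move=> m [u] /=; rewrite hS0 l1norm_restrict12 => -[u1 _] <-.
    by rewrite -hS0 cardS0 qE hphi2; exact: design_form_compat.
  (* Equality case of [quad_min] at t = 1: its remainder square vanishes at c + d = - 2 s. *)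
  pose s := C * phi2 / 4 / (C ^+ 2 * phi2 / 2 + tau2).
  have s_ge0 : 0 <= s by rewrite divr_ge0 ?(ltW D_gt0) //; nra.
  exists (col4 (1 / 2) (1 / 2) (- s) (- s)).
    rewrite hS0 /= l1norm_restrict12 l1norm_restrict34 !mxE /=.
    split; first by rewrite ger0_norm; lra.
    rewrite normrN ger0_norm //.
    (* Feasibility of the witness rests on C > 1, through C phi2 / 4 <= C^2 phi2 / 4. *)
    have : s <= 1 / 2 by rewrite ler_pdivrMr //; nra.
    by lra.
  rewrite cardS0 qE !mxE /= /design_form /s.
  have -> : 1 - rho = phi2 by rewrite hphi2.
  by field; apply: lt0r_neq0; lra.
have effE : eff_sparsity2 X S0 = 2 / phi2 + C ^+ 2 / tau2.
  rewrite /eff_sparsity2 compatE cardS0.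
  field; rewrite ?lt0r_neq0 //; lra.
split=> // lambda betas l_gt0 b21 b2 hmin; rewrite effE hS0 l1norm_restrict34.
have /setP act := etrans hact hS0.
have b3 : beta0 j3 0 = 0.
  by have := act j3; rewrite !inE /= => /negbFE/eqP.
have b4 : beta0 j4 0 = 0.
  by have := act j4; rewrite !inE /= => /negbFE/eqP.
(* Stationarity at the deviation (- e, - e, s, s) reads phi2 (e - C s) = lambda in the active
   coordinates; the other two then give 2 tau2 s = lambda (C - 1). *)
pose e := lambda / phi2 + lambda * C * (C - 1) / (2 * tau2).
pose s := lambda * (C - 1) / (2 * tau2).
have s_ge0 : 0 <= s by rewrite divr_ge0 //; nra.
have x1_ge0 : 0 <= beta0 j1 0 - e by rewrite /e; lra.
have x2_ge0 : 0 <= beta0 j2 0 - e by rewrite /e; lra.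
have := hmin (col4 (beta0 j1 0 - e) (beta0 j2 0 - e) s s).
rewrite /lasso_objective !qE !l1norm_I4 !mxE /= b3 b4 !subr0.
have -> : beta0 j1 0 - e - beta0 j1 0 = - e by ring.
have -> : beta0 j2 0 - e - beta0 j2 0 = - e by ring.
rewrite (ger0_norm s_ge0) (ger0_norm x1_ge0) (ger0_norm x2_ge0).
set x1 := betas j1 0; set x2 := betas j2 0.
set x3 := betas j3 0; set x4 := betas j4 0.
(* The KKT conditions at the candidate: the gradient there is [- 2 lambda]
   in every coordinate. *)
have expand : design_form rho tau2 w C (x1 - beta0 j1 0) (x2 - beta0 j2 0) x3 x4
  = design_form rho tau2 w C (- e) (- e) s s
    - 2 * lambda * (x1 - (beta0 j1 0 - e) + (x2 - (beta0 j2 0 - e))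
                    + (x3 - s) + (x4 - s))
    + design_form rho tau2 w C (x1 - (beta0 j1 0 - e)) (x2 - (beta0 j2 0 - e))
        (x3 - s) (x4 - s).
  rewrite /design_form.
  have -> : rho = 1 - phi2 by rewrite hphi2; ring.
  by rewrite /e /s; field; rewrite !lt0r_neq0.
move=> le_obj.
have sgn_ge0 (x : R) : 0 <= `|x| - x by rewrite subr_ge0 ler_norm.
(* With [expand], [le_obj] says that the form at the difference from the candidate, plus twice this
   nonnegative slack, is at most 0. *)
have abs_ge :
    0 <= lambda * ((`|x1| - x1) + (`|x2| - x2) + (`|x3| - x3) + (`|x4| - x4)).
  exact: mulr_ge0 (ltW l_gt0)
    (addr_ge0 (addr_ge0 (addr_ge0 (sgn_ge0 _) (sgn_ge0 _)) (sgn_ge0 _)) (sgn_ge0 _)).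
have : design_form rho tau2 w C (x1 - (beta0 j1 0 - e)) (x2 - (beta0 j2 0 - e))
    (x3 - s) (x4 - s) <= 0 by lra.
move=> /(design_form_le0 hrho tau_gt0 w_gt0)[e1 e2 e3 e4].
(* At the candidate the prediction error is lambda^2 (2 / phi2 + (C - 1)^2 / tau2) and the penalty
   is 2 lambda^2 (C - 1) / tau2; then (C - 1)^2 + 2 (C - 1) = C^2 - 1. *)
rewrite expand e1 e2 e3 e4.
have -> : x3 = s by lra.
have -> : x4 = s by lra.
rewrite ger0_norm // /design_form.
have -> : rho = 1 - phi2 by rewrite hphi2; ring.
by rewrite /e /s; field; rewrite !lt0r_neq0.
Qed.
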